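(* Let $(Y,X,D)$ be random with $Y\in\mathbb R$, $X\in\mathbb R^p$, $D\in\{0,1\}$, and consider the linear regression model $Y=\alpha+\beta D+s(X)'\gamma+E$. Let $Z=(1,D,s(X)')'$, and suppose that $\mathbf E[\|Z\|^2]$ and $\mathbf E[\|ZE\|]$ are finite, $\mathbf E[ZZ']$ is positive definite, and $\mathbf E[ZE]=\mathbf 0$. Suppose the supports $\mathcal X^1,\mathcal X^0$ of $G^1,G^0$ are finite. Let $\mathcal J$ be a finite index set, $r(x)=(r_j(x))_{j\in\mathcal J}$ a vector of real-valued functions (''summaries'') of $x$, and $L\in[0,\infty]$. For each $\sigma\in\{1,-1\}$ let $(\zeta_\sigma^\star,\xi_\sigma^{1\star},\xi_\sigma^{0\star})$ be a solution of the problem of minimizing $$\|\zeta_\sigma\|^2+L\sum_{d\in\{0,1\}}\sum_{x\in\mathcal X^d}\xi_\sigma^d(x)$$ over $\zeta_\sigma\in\mathbb R^{\mathcal J}$, $\xi_\sigma^1\in\mathbb R_+^{\mathcal X^1}$, $\xi_\sigma^0\in\mathbb R_+^{\mathcal X^0}$, subject to $$\sigma(f(x,0)-l_\theta^s(x,0))\le\sigma\, r(x)'\zeta_\sigma+\xi_\sigma^1(x)\ \text{ for every }x\in\mathcal X^1,$$ $$\sigma(f(x,0)-l_\theta^s(x,0))\ge\sigma\, r(x)'\zeta_\sigma-\xi_\sigma^0(x)\ \text{ for every }x\in\mathcal X^0.$$ Define $m_\sigma^{\mathrm{MD}}=|\zeta_\sigma^\star|$, $m^{\mathrm{MD}}=m_1^{\mathrm{MD}}\vee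 m_{-1}^{\mathrm{MD}}$ and $c^{\mathrm{MD}}=\bigl|\mathbf E_{G^1}[r(\cdot)]-\mathbf E_{G^0}[r(\cdot)]\bigr|$ (absolute values and maxima taken componentwise in $\mathbb R^{\mathcal J}$). Then $$-m_{-1}^{\mathrm{MD}\prime}c^{\mathrm{MD}}-\sum_{d\in\{0,1\}}\mathbf E_{G^d}[\xi_{-1}^{d\star}(\cdot)]\ \le\ \beta-\tau\ \le\ m_1^{\mathrm{MD}\prime}c^{\mathrm{MD}}+\sum_{d\in\{0,1\}}\mathbf E_{G^d}[\xi_1^{d\star}(\cdot)].$$ In particular, $|\beta-\tau|\le m^{\mathrm{MD}\prime}c^{\mathrm{MD}}+\sum_{\sigma=\pm1}\sum_{d\in\{0,1\}}\mathbf E_{G^d}[\xi_\sigma^{d\star}(\cdot)]$.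
   Context: For $d\in\{0,1\}$, $G^d$ is the conditional distribution of $X$ given $D=d$, with support $\mathcal X^d\subseteq\mathbb R^p$, and $\mathbf E_{G^d}[\phi(\cdot)]=\int\phi\,\mathrm dG^d$. $F$ is the conditional distribution of $Y$ given $(X',D)'$, regarded as a given kernel defined for $(x,d)\in(\mathcal X^0\cup\mathcal X^1)\times\{0,1\}$, and $f(x,d)=\mathbf E[Y|X=x,D=d]$ is its (finite) mean. The parameter of interest is $$\tau=\mathbf E[Y|D=1]-\mathbf E[\mathbf E[Y|X,D=0]|D=1]=\mathbf E[Y|D=1]-\int f(x,0)\,G^1(\mathrm dx).$$ $s$ is a map from $\mathbb R^p$ to a finite-dimensional Euclidean space, $\theta=(\alpha,\beta,\gamma')'$, and $l_\theta^s(x,d)=\alpha+\beta d+s(x)'\gamma$. $\mathbb R_+=[0,\infty)$; when $L=\infty$ use $\infty\cdot0=0$. *)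

(* Defs.v *)
From HB Require Import structures.
From mathcomp Require Import all_boot all_order all_algebra.
From mathcomp Require Import all_classical all_reals all_analysis.
Import Order.TTheory GRing.Theory Num.Theory.
Import numFieldNormedType.Exports.

Set Implicit Arguments.
Unset Strict Implicit.
Unset Printing Implicit Defensive.

Local Open Scope classical_set_scope.
Local Open Scope ring_scope.

(* R^p, as a space of column vectors, with its Borel sigma-algebra. *)
Notation borel_cV R p := (g_sigma_algebraType (@open 'cV[R]_p)).

(* The Euclidean norm: the norm that the library puts on matrices is the
   maximum norm. *)
Definition enorm (R : realType) (n : nat) (v : 'cV[R]_n) : R :=
  Num.sqrt (\sum_i v i 0 ^+ 2).

Definition posdef (R : realType) (n : nat) (M : 'M[R]_n) : Prop :=
  M^T = M /\ forall v : 'cV[R]_n, v != 0 -> 0 < (v^T *m M *m v) 0 0.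

Definition expectation_mx (d : measure_display) (T : measurableType d)
    (R : realType) (P : probability T R) (m n : nat) (M : T -> 'M[R]_(m, n)) :
    'M[R]_(m, n) :=
  \matrix_(i, j) fine ('E_P[fun w => M w i j]).

Definition cond_mean (d : measure_display) (T : measurableType d)
    (R : realType) (P : probability T R) (Y : T -> R) (A : set T) : R :=
  (\int[P]_(w in A) Y w) / fine (P A).

(* The support of a law on R^p: the smallest closed set of probability one. *)
Definition support_of (R : realType) (p : nat)
    (G : probability (borel_cV R p) R) : set 'cV[R]_p :=
  \bigcap_(C in [set C : set 'cV[R]_p | closed C /\ G C = 1%E]) C.

(* For phi defined on the support of G only, its values elsewhere being junk;
   the domain of integration carries the whole mass of G. *)
Definition support_mean (R : realType) (p : nat)
    (G : probability (borel_cV R p) R) (phi : 'cV[R]_p -> R) : R :=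
  \int[G]_(x in support_of G) phi x.

(* Treatment values are booleans, with true standing for 1 and false for 0. *)
Definition cond_law_X (d : measure_display) (T : measurableType d)
    (R : realType) (P : probability T R) (p : nat)
    (X : T -> borel_cV R p) (D : T -> bool)
    (G : bool -> probability (borel_cV R p) R) : Prop :=
  forall (a : bool) (A : set (borel_cV R p)), measurable A ->
    P (X @^-1` A `&` D @^-1` [set a]) = (P (D @^-1` [set a]) * G a A)%E.

(* F is a regular conditional distribution of Y given (X, D). The kernel is
   only given on S * {0, 1}, where S carries the law of X: its values outside S
   are junk. No measurability in x is requested, since S will be finite. *)
Definition cond_law_Y (d : measure_display) (T : measurableType d)
    (R : realType) (P : probability T R) (p : nat)
    (Y : T -> R) (X : T -> borel_cV R p) (D : T -> bool)
    (S : set 'cV[R]_p) (F : 'cV[R]_p -> bool -> probability R R) : Prop :=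
  forall (a : bool) (A : set (borel_cV R p)) (B : set R),
    measurable A -> measurable B ->
    P (Y @^-1` B `&` X @^-1` A `&` D @^-1` [set a])
    = (\int[P]_(w in X @^-1` (A `&` S) `&` D @^-1` [set a]) F (X w) a B)%E.

Definition cond_mean_fun (R : realType) (p : nat)
    (F : 'cV[R]_p -> bool -> probability R R) (x : 'cV[R]_p) (a : bool) : R :=
  \int[F x a]_y y.

Definition tau (d : measure_display) (T : measurableType d)
    (R : realType) (P : probability T R) (p : nat) (Y : T -> R) (D : T -> bool)
    (G : bool -> probability (borel_cV R p) R)
    (f : 'cV[R]_p -> bool -> R) : R :=
  cond_mean P Y (D @^-1` [set true])
  - support_mean (G true) (fun x => f x false).

(* The regression function l and the regressor Z = (1, D, s(X)')'. *)
Definition lin_reg (R : realType) (p q : nat) (s : 'cV[R]_p -> 'cV[R]_q)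
    (alpha beta : R) (gamma : 'cV[R]_q) (x : 'cV[R]_p) (a : bool) : R :=
  alpha + beta * a%:R + ((s x)^T *m gamma) 0 0.

Definition regressor (R : realType) (p q : nat) (s : 'cV[R]_p -> 'cV[R]_q)
    (x : 'cV[R]_p) (a : bool) : 'cV[R]_(1 + (1 + q)) :=
  col_mx 1%:M (col_mx (a%:R)%:M (s x)).

Definition dot (R : realType) (J : finType) (u v : J -> R) : R :=
  \sum_j u j * v j.

(* In the next two definitions xi a is only looked at on the support of G a. *)
Definition MD_feasible (R : realType) (p : nat) (J : finType)
    (G : bool -> probability (borel_cV R p) R)
    (f l : 'cV[R]_p -> bool -> R) (r : 'cV[R]_p -> J -> R) (sigma : R)
    (zeta : J -> R) (xi : bool -> 'cV[R]_p -> R) : Prop :=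
  [/\ forall a x, support_of (G a) x -> 0 <= xi a x,
      forall x, support_of (G true) x ->
        sigma * (f x false - l x false)
          <= sigma * dot (r x) zeta + xi true x
    & forall x, support_of (G false) x ->
        sigma * dot (r x) zeta - xi false x
          <= sigma * (f x false - l x false)].

(* Valued in the extended reals, where +oo * 0 = 0. *)
Definition MD_objective (R : realType) (p : nat) (J : finType)
    (G : bool -> probability (borel_cV R p) R) (L : \bar R)
    (zeta : J -> R) (xi : bool -> 'cV[R]_p -> R) : \bar R :=
  ((\sum_j zeta j ^+ 2)%:E
   + L * (\sum_(a : bool) \sum_(x \in support_of (G a)) xi a x)%:E)%E.

Definition MD_solution (R : realType) (p : nat) (J : finType)
    (G : bool -> probability (borel_cV R p) R)
    (f l : 'cV[R]_p -> bool -> R) (r : 'cV[R]_p -> J -> R) (L : \bar R)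
    (sigma : R) (zeta : J -> R) (xi : bool -> 'cV[R]_p -> R) : Prop :=
  MD_feasible G f l r sigma zeta xi /\
  forall zeta' xi', MD_feasible G f l r sigma zeta' xi' ->
    (MD_objective G L zeta xi <= MD_objective G L zeta' xi')%E.

(* Main.v *)
(* Orthogonality of the error E to the constant and to D gives E an integral of
   zero over each of the events D = 1 and D = 0, so the mean of Y given D = a is
   the mean of l(., a) over G^a, while by definition of F it is also the mean of
   f(., a). Hence beta - tau is the mean over G^1 of h = f(., 0) - l(., 0), and
   the mean of h over G^0 vanishes. Averaging the constraints of the minimum
   distance problems over G^1 and G^0 then bounds the mean of h over G^1. *)
Require Import Defs.
From HB Require Import structures.
From mathcomp Require Import finmap.
From mathcomp Require Import all_boot all_order all_algebra.
From mathcomp Require Import all_classical all_reals all_analysis.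
From mathcomp Require Import measurable_realfun.
From mathcomp Require Import ring lra.
Import Order.TTheory GRing.Theory Num.Theory.
Import numFieldNormedType.Exports.

Set Implicit Arguments.
Unset Strict Implicit.
Unset Printing Implicit Defensive.

Local Open Scope classical_set_scope.
Local Open Scope ring_scope.

(** * The support of a law on R^p and its mass *)

Section support.
Context {R : realType} {p : nat}.
Implicit Type G : probability (borel_cV R p) R.

Lemma open_borel_cV (A : set 'cV[R]_p) :
  open A -> measurable (A : set (borel_cV R p)).
Proof. by move=> oA; apply: sub_sigma_algebra. Qed.

Lemma closed_borel_cV (A : set 'cV[R]_p) :
  closed A -> measurable (A : set (borel_cV R p)).
Proof.
move=> /closed_openC oA; rewrite -(setCK A).
by apply: measurableC; exact: open_borel_cV.
Qed.

Lemma closed_support G : closed (support_of G).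
Proof. by apply: closed_bigI => C []. Qed.

Lemma measurable_support G :
  measurable (support_of G : set (borel_cV R p)).
Proof. by apply: closed_borel_cV; exact: closed_support. Qed.

Lemma closed_cV1 (x : 'cV[R]_p) : closed [set x].
Proof. exact/accessible_closed_set1/hausdorff_accessible/norm_hausdorff. Qed.

Lemma measurable_cV1 (x : 'cV[R]_p) :
  measurable ([set x] : set (borel_cV R p)).
Proof. by apply: closed_borel_cV; exact: closed_cV1. Qed.

(** Balls of column vectors are products of intervals, so the centre can be picked entry by entry by
    density of the rationals. A radius below half that of a ball around [x] inside [U] lets the
    triangle inequality keep the new ball in [U]. This supplies a countable base for the
    topology. *)
Lemma rat_ball_in_nbhs (x : 'cV[R]_p) (U : set 'cV[R]_p) : nbhs x U ->
  exists (c : 'cV[rat]_p) (n : nat),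
    ball (map_mx ratr c : 'cV[R]_p) n.+1%:R^-1 x /\
    ball (map_mx ratr c : 'cV[R]_p) n.+1%:R^-1 `<=` U.
Proof.
move=> /nbhs_ballP[e /= e0 xeU].
have [n _ ne] : exists2 n, True & n.+1%:R^-1 < e / 2.
  have [n _ /(_ n (leqnn n))] :=
    near_infty_natSinv_lt (PosNum (divr_gt0 e0 (ltr0Sn R 1))).
  by exists n.
have /choice[c xc] (i : 'I_p) :
    exists c : rat, ball (x i 0) n.+1%:R^-1 (ratr c).
  have xlt : x i 0 - n.+1%:R^-1 < x i 0 + n.+1%:R^-1.
    by rewrite ltrD2l gtrN// invr_gt0.
  have [c] := rat_in_itvoo xlt.
  rewrite in_itv/= => /andP[? ?]; exists c.
  by rewrite /ball/= ltr_distlC; apply/andP.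
exists (\col_i c i), n.
have cx : ball (map_mx ratr (\col_i c i) : 'cV[R]_p) n.+1%:R^-1 x.
  split; first by rewrite invr_gt0.
  by move=> i j; rewrite !mxE (ord1 j); apply: ball_sym; exact: xc.
split=> // y cy; apply: xeU; rewrite (splitr e).
apply: ball_triangle (le_ball (ltW ne) (ball_sym cx)) (le_ball (ltW ne) cy).
Qed.

(* The complement of the support is a union of null balls taken from the
   countable family of balls with rational centre and radius 1/n. *)
Lemma support_mass1 G : G (support_of G) = 1%E.
Proof.
pose B (cn : 'cV[rat]_p * nat) : set 'cV[R]_p :=
  ball (map_mx ratr cn.1 : 'cV[R]_p) cn.2.+1%:R^-1.
have mB cn : measurable (B cn : set (borel_cV R p)).
  by apply: open_borel_cV; exact: ball_open.
(* The balls are enumerated through their codes. A number that codes no ball, or a ball of nonzero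
   mass, contributes the empty set, so every [N k] is null. *)
pose N (k : nat) : set (borel_cV R p) :=
  if unpickle k is Some cn then
    if G (B cn) == 0%E then B cn else set0
  else set0.
have N0 (k : nat) : negligible G (N k).
  rewrite /N; case: unpickle => [cn|]; last exact: negligible_set0.
  case: eqP => [GB0|_]; last exact: negligible_set0.
  by apply/negligibleP; [exact: mB|].
have SN : ~` support_of G `<=` \bigcup_k N k.
  move=> x /existsNP[C /not_implyP[[cC GC1] Cx]].
  have /rat_ball_in_nbhs[c [n [cx cC']]] : nbhs x (~` C).
    by apply: open_nbhs_nbhs; split => //; exact: closed_openC.
  exists (pickle (c, n)) => //; rewrite /N pickleK.
  case: eqP => //; case; apply/eqP; rewrite eq_le measure_ge0 andbT.
  have mC : measurable (C : set (borel_cV R p)) by exact: closed_borel_cV.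
  have <- : G (~` C) = 0%E by rewrite probability_setC// GC1 subee.
  apply: le_measure => //; apply: mem_set; [exact: mB|exact: measurableC].
have mS := measurable_support G.
have := @negligibleS _ (borel_cV R p) _ G _
  (~` support_of G) SN (negligible_bigcup N0).
move=> /negligibleP SC0.
rewrite -(setCK (support_of G)) probability_setC ?SC0 ?sube0//;
  exact: measurableC.
Qed.

End support.

(** * Integrals over a set cut into finitely many fibres *)

Section finite_fibres.
Context {d d' : measure_display} {T : measurableType d} {V : measurableType d'}.
Context {R : realType}.
Variables (mu : {measure set T -> \bar R}) (D : set T) (Z : T -> V) (S : set V).
Hypotheses (mD : measurable D) (mZ : measurable_fun setT Z).
Hypotheses (mV1 : forall x : V, measurable [set x]) (finS : finite_set S).
Hypothesis mu0 : mu (D `\` Z @^-1` S) = 0%E.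

Let fibre x := D `&` Z @^-1` [set x].

Let mpreim (A : set V) : measurable A -> measurable (Z @^-1` A).
Proof. by move=> mA; rewrite -(setTI (Z @^-1` A)); exact: mZ. Qed.

Let mfibre x : measurable (fibre x).
Proof. by apply: measurableI => //; exact: mpreim. Qed.

Let tfibre A : trivIset A fibre.
Proof. by move=> x y _ _ [t [[_ <-] [_ <-]]]. Qed.

Let mS : measurable S.
Proof.
rewrite -(image_id S) -bigcup_imset1.
by apply: fin_bigcup_measurable.
Qed.

Let mN : measurable (D `\` Z @^-1` S).
Proof. by apply: measurableD => //; exact: mpreim. Qed.

(** Discarding the null part of [D] where [Z] leaves [S] turns [D] into a finite disjoint union, the
    form required by additivity of the integral. *)
Let DE : D `\` (D `\` Z @^-1` S) = \big[setU/set0]_(x <- fset_set S) fibre x.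
Proof.
rewrite -bigcup_fset; apply/seteqP; split => [t [Dt]|t [x/=]].
  move=> Nt; have SZt : S (Z t) by apply: contrapT => nS; apply: Nt.
  by exists (Z t) => //=; rewrite in_fset_set//; exact: mem_set.
rewrite in_fset_set// => /set_mem Sx [Dt SZt]; split=> //.
by case=> _; apply; rewrite /= SZt.
Qed.

(** The integral of [|W|] over [D] is a finite sum of integrals over fibres, each of them finite. *)
Lemma integrable_finite_fibres (W : T -> R) : measurable_fun D W ->
  (forall x, S x -> mu.-integrable (D `&` Z @^-1` [set x]) (EFin \o W)) ->
  mu.-integrable D (EFin \o W).
Proof.
move=> mW iW; apply/integrableP; split; first exact/measurable_EFinP.
have mWa : measurable_fun D (fun t => `|(EFin \o W) t|%E).
  by apply/measurableT_comp => //; exact/measurable_EFinP.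
rewrite (ge0_negligible_integral mN mD mWa)// DE.
rewrite ge0_integral_bigsetU//; last 1 first.
  by rewrite -DE; apply: measurable_funS mWa => // t [].
rewrite big_seq; apply: lte_sum_pinfty => x.
rewrite in_fset_set// => /set_mem Sx.
by have /integrableP[] := iW _ Sx.
Qed.

Lemma Rintegral_finite_fibres (W : T -> R) : mu.-integrable D (EFin \o W) ->
  \int[mu]_(t in D) W t =
  \sum_(x <- fset_set S) \int[mu]_(t in D `&` Z @^-1` [set x]) W t.
Proof.
move=> iW; rewrite /Rintegral (negligible_integral mN mD iW)// DE.
rewrite integral_bigsetU_EFin//; last first.
  by rewrite -DE; apply: measurable_funS (measurable_int _ iW) => // t [].
rewrite sum_fine//= => x _.
apply: integrable_fin_num; first exact: mfibre.
by apply: (integrableS mD (mfibre x) _ iW) => t [].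
Qed.

End finite_fibres.

(** * Means over a finite support *)

Section support_mean.
Context {R : realType} {p : nat}.
Variable G : probability (borel_cV R p) R.
Hypothesis finG : finite_set (support_of G).

(** On a finite set of points any function is measurable, preimages being finite, and it is
    integrable because it is constant on each singleton. The order and linearity rules below thus
    hold for arbitrary functions and reduce to rules for finite sums. *)
Lemma support_meanE (phi : 'cV[R]_p -> R) :
  support_mean G phi =
  \sum_(x <- fset_set (support_of G)) phi x * fine (G [set x]).
Proof.
set S := support_of G.
have mS : measurable (S : set (borel_cV R p)) by exact: measurable_support.
have m1 (x : borel_cV R p) : measurable [set x] by exact: measurable_cV1.
have SN : G (S `\` (id : borel_cV R p -> borel_cV R p) @^-1` S) = 0%E.
  by rewrite setDv measure0.
have fib (x : borel_cV R p) : S x -> S `&` id @^-1` [set x] = [set x].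
  by move=> Sx; apply/seteqP; split => [y []//|y /= ->].
have mphi : measurable_fun (S : set (borel_cV R p)) phi.
  move=> _ B mB; rewrite -(image_id (S `&` _)) -bigcup_imset1.
  apply: fin_bigcup_measurable => //; apply: sub_finite_set finG.
  exact: subIsetl.
have iphi (x : borel_cV R p) : S x ->
    G.-integrable (S `&` id @^-1` [set x]) (EFin \o phi).
  move=> Sx; rewrite fib//.
  apply: (eq_integrable (m1 x) (EFin \o cst (phi x))).
    by move=> y /set_mem/= ->.
  exact: finite_measure_integrable_cst.
have mid : measurable_fun setT (id : borel_cV R p -> borel_cV R p).
  exact: measurable_id.
rewrite /support_mean (Rintegral_finite_fibres mS mid m1 finG SN); last first.
  exact: (integrable_finite_fibres mS mid m1 finG SN).
rewrite !big_seq; apply: eq_bigr => x.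
rewrite in_fset_set// => /set_mem Sx; rewrite fib//.
rewrite (@eq_Rintegral _ _ _ _ _ (cst (phi x))) ?Rintegral_cst//.
by move=> y /set_mem/= ->.
Qed.

Lemma le_support_mean (phi psi : 'cV[R]_p -> R) :
  (forall x, support_of G x -> phi x <= psi x) ->
  support_mean G phi <= support_mean G psi.
Proof.
move=> le; rewrite !support_meanE !big_seq; apply: ler_sum => x.
rewrite in_fset_set// => /set_mem Sx.
by rewrite ler_wpM2r ?fine_ge0// le.
Qed.

Lemma eq_support_mean (phi psi : 'cV[R]_p -> R) :
  (forall x, support_of G x -> phi x = psi x) ->
  support_mean G phi = support_mean G psi.
Proof.
by move=> e; apply/eqP; rewrite eq_le !le_support_mean// => x /e ->.
Qed.

Lemma support_meanD (phi psi : 'cV[R]_p -> R) :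
  support_mean G (fun x => phi x + psi x) =
  support_mean G phi + support_mean G psi.
Proof.
by rewrite !support_meanE -big_split; apply: eq_bigr => x _; rewrite mulrDl.
Qed.

Lemma support_meanZ (k : R) (phi : 'cV[R]_p -> R) :
  support_mean G (fun x => k * phi x) = k * support_mean G phi.
Proof.
by rewrite !support_meanE mulr_sumr; apply: eq_bigr => x _; rewrite mulrA.
Qed.

Lemma support_meanB (phi psi : 'cV[R]_p -> R) :
  support_mean G (fun x => phi x - psi x) =
  support_mean G phi - support_mean G psi.
Proof.
rewrite -mulN1r -support_meanZ -support_meanD.
by apply: eq_support_mean => x _; rewrite mulN1r.
Qed.

Lemma support_mean_dot (J : finType) (r : 'cV[R]_p -> J -> R) (zeta : J -> R) :
  support_mean G (fun x => dot (r x) zeta) =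
  dot (fun j => support_mean G (r^~ j)) zeta.
Proof.
rewrite support_meanE /dot.
under eq_bigr do rewrite mulr_suml.
rewrite exchange_big; apply: eq_bigr => j _ /=.
by rewrite support_meanE mulr_suml; apply: eq_bigr => x _; rewrite mulrAC.
Qed.

(** The support carries the whole mass of [G], by [support_mass1]. *)
Lemma support_mean_cst (k : R) : support_mean G (fun=> k) = k.
Proof.
rewrite /support_mean Rintegral_cst; last exact: measurable_support.
by rewrite [X in fine X](support_mass1 G) mulr1.
Qed.

Lemma support_mean_ge0 (phi : 'cV[R]_p -> R) :
  (forall x, support_of G x -> 0 <= phi x) -> 0 <= support_mean G phi.
Proof. by move=> phi0; rewrite -(support_mean_cst 0) le_support_mean. Qed.

End support_mean.

(* Averaging the constraints over G^1 and G^0 and adding them cancels the mean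
   of h over G^0; only the balance of the summaries r and the slacks remain. *)
Lemma MD_feasible_bound (R : realType) (p : nat) (J : finType)
    (G : bool -> probability (borel_cV R p) R)
    (f l : 'cV[R]_p -> bool -> R) (r : 'cV[R]_p -> J -> R) (sigma : R)
    (zeta : J -> R) (xi : bool -> 'cV[R]_p -> R) :
  (forall a, finite_set (support_of (G a))) -> `|sigma| <= 1 ->
  support_mean (G false) (fun x => f x false - l x false) = 0 ->
  MD_feasible G f l r sigma zeta xi ->
  sigma * support_mean (G true) (fun x => f x false - l x false) <=
  dot (fun j => `|zeta j|) (fun j =>
    `|support_mean (G true) (r^~ j) - support_mean (G false) (r^~ j)|)
  + \sum_(a : bool) support_mean (G a) (xi a).
Proof.
move=> finG sigma1 h0 [_ feas1 feas0].
have := le_support_mean (finG false) feas0.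
rewrite [X in X <= _]support_meanB// !support_meanZ// support_mean_dot//.
rewrite h0 mulr0.
move=> le0; have := le_support_mean (finG true) feas1.
rewrite [X in _ <= X]support_meanD// !support_meanZ// support_mean_dot// => le1.
rewrite big_bool/=.
suff : sigma * dot (fun j => support_mean (G true) (r^~ j)) zeta
    - sigma * dot (fun j => support_mean (G false) (r^~ j)) zeta
    <= dot (fun j => `|zeta j|) (fun j =>
    `|support_mean (G true) (r^~ j) - support_mean (G false) (r^~ j)|).
  by lra.
rewrite -mulrBr /dot -sumrB mulr_sumr; apply: ler_sum => j _.
rewrite -mulrBl; apply: le_trans (ler_norm _) _.
by rewrite normrM normrM (mulrC `|zeta j|) ler_piMl.
Qed.

(** * Integrals under a conditional law, and domination *)

(** The hypothesis on [F] says that the image under [Y] of [P] restricted to [A] is [F] scaled by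
    [P A]; the claim is then a change of variables. *)
Lemma ge0_integral_conditional_law d (T : measurableType d) (R : realType)
    (P : probability T R) (A : set T) (Y : {RV P >-> R}) (F : probability R R)
    (g : R -> \bar R) : measurable A ->
  (forall B, measurable B -> P (Y @^-1` B `&` A) = (P A * F B)%E) ->
  measurable_fun [set: R] g -> (forall y, 0 <= g y)%E ->
  (\int[P]_(w in A) g (Y w) = P A * \int[F]_y g y)%E.
Proof.
move=> mA hF mg g0.
have PA0 : 0 <= fine (P A) by rewrite fine_ge0.
have PAE : P A = (fine (P A))%:E by rewrite fineK// fin_num_measure.
have mgY : measurable_fun setT (g \o Y) by exact: measurableT_comp.
(* The restricted measure gives the complement of [A] no mass and agrees with [P] on measurable
   subsets of [A]. *)
have restrE : (\int[P]_(w in A) g (Y w) = \int[mrestr P mA]_w g (Y w))%E.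
  rewrite (@ge0_negligible_integral _ _ _ (mrestr P mA) setT (~` A))//=;
    last first.
  - by rewrite /mrestr/= setICl.
  - exact: measurableC.
  rewrite setTD setCK.
  apply: eq_measure_integral => B mB BA.
  by change (P B = P (B `&` A)); rewrite setIidl.
rewrite restrE -[LHS]/(\int[mrestr P mA]_(w in Y @^-1` setT) (g \o Y) w)%E.
rewrite -ge0_integral_pushforward//.
rewrite (eq_measure_integral (mscale (NngNum PA0) F)); last first.
  move=> B mB _; transitivity (P (Y @^-1` B `&` A)) => //.
  by rewrite hF// [in LHS]PAE.
by rewrite ge0_integral_mscale//= -PAE.
Qed.

(** The nonnegative case applies to the positive and negative parts of the identity. Both have
    finite integrals under [F], so their difference is meaningful and the factor [P A] distributes
    over it. *)
Lemma Rintegral_conditional_law d (T : measurableType d) (R : realType)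
    (P : probability T R) (A : set T) (Y : {RV P >-> R}) (F : probability R R) :
  measurable A ->
  (forall B, measurable B -> P (Y @^-1` B `&` A) = (P A * F B)%E) ->
  F.-integrable setT EFin ->
  \int[P]_(w in A) Y w = fine (P A) * \int[F]_y y.
Proof.
move=> mA hF iF; rewrite /Rintegral.
have mid : measurable_fun [set: R] (EFin : R -> \bar R).
  exact/measurable_EFinP.
rewrite integralE [in RHS]integralE.
have -> : (\int[P]_(w in A) (EFin \o Y)^\+ w = P A * \int[F]_y EFin^\+ y)%E.
  rewrite -(ge0_integral_conditional_law mA hF)//.
    by apply: eq_integral => w _; rewrite !funeposE.
  exact: measurable_funepos.
have -> : (\int[P]_(w in A) (EFin \o Y)^\- w = P A * \int[F]_y EFin^\- y)%E.
  rewrite -(ge0_integral_conditional_law mA hF)//.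
    by apply: eq_integral => w _; rewrite !funenegE.
  exact: measurable_funeneg.
have Fp := integrable_pos_fin_num measurableT iF.
have Fn := integrable_neg_fin_num measurableT iF.
have Fpn : (\int[F]_y EFin^\+ y - \int[F]_y EFin^\- y)%E \is a fin_num.
  by rewrite fin_numB Fp Fn.
rewrite -muleBr ?fin_num_measure// ?fineM ?fin_num_measure//.
by rewrite fin_num_adde_defr.
Qed.

(* h need not be measurable: the integral of a nonnegative function is the
   supremum over the simple functions below it. *)
Lemma integrable_of_le d (T : measurableType d) (R : realType)
    (mu : {measure set T -> \bar R}) (W h : T -> R) :
  measurable_fun setT W -> (forall t, `|W t| <= h t) ->
  (\int[mu]_t (h t)%:E < +oo)%E -> mu.-integrable setT (EFin \o W).
Proof.
move=> mW Wh hoo; apply/integrableP; split; first exact/measurable_EFinP.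
apply: le_lt_trans hoo; rewrite !ge0_integralE//; last first.
  by move=> t _; rewrite lee_fin (le_trans _ (Wh t)).
apply: ereal_sup_le => _ [k kW <-]; exists k => // t.
apply: le_trans (kW t) _.
by rewrite !patchE in_setT /= lee_fin.
Qed.

Lemma norm_le_enorm (R : realType) (n : nat) (v : 'cV[R]_n) (i : 'I_n) :
  `|v i 0| <= enorm v.
Proof.
rewrite /enorm -sqrtr_sqr ler_wsqrtr// (bigD1 i)//= lerDl.
by apply: sumr_ge0 => j _; rewrite sqr_ge0.
Qed.

(** * Entries of the regressor and positivity of the treatment probabilities *)

Section regressor_entries.
Context {R : realType} {p q : nat}.
Variable s : 'cV[R]_p -> 'cV[R]_q.

Definition const_idx : 'I_(1 + (1 + q)) := lshift _ 0.
Definition treat_idx : 'I_(1 + (1 + q)) := rshift 1 (lshift _ 0).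

Lemma regressor_const x a : regressor s x a const_idx 0 = 1.
Proof. by rewrite /regressor col_mxEu mxE eqxx. Qed.

Lemma regressor_treat x a : regressor s x a treat_idx 0 = a%:R.
Proof. by rewrite /regressor col_mxEd col_mxEu mxE eqxx. Qed.

End regressor_entries.

Lemma mx_delta_form (R : realType) (n : nat) (M : 'M[R]_n) (i j : 'I_n) :
  ((delta_mx i 0 : 'cV[R]_n)^T *m M *m (delta_mx j 0 : 'cV[R]_n)) 0 0 = M i j.
Proof. by rewrite trmx_delta -rowE -colE !mxE. Qed.

Section posdef_treatment.
Context {d : measure_display} {T : measurableType d} {R : realType}.
Context {p q : nat}.
Variables (P : probability T R) (X : T -> 'cV[R]_p) (D : {RV P >-> bool}).
Variable s : 'cV[R]_p -> 'cV[R]_q.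

Lemma measurable_treatment a : measurable (D @^-1` [set a]).
Proof. by rewrite -(setTI (D @^-1` _)); exact: measurable_funP. Qed.

Lemma expectation_treated :
  fine 'E_P[fun w => (D w)%:R] = fine (P (D @^-1` [set true])).
Proof.
rewrite -expectation_indic; last exact: measurable_treatment.
congr (fine 'E_P[_]); apply/funext => w; rewrite indicE.
congr ((nat_of_bool _)%:R).
by apply/idP/idP => [Dw|/set_mem//]; exact/mem_set.
Qed.

(* The quadratic form is P(D = 1) at the coordinate vector of D, and P(D = 0)
   once the coordinate vector of the constant is subtracted. *)
Lemma posdef_treatment_gt0 (a : bool) :
  posdef (expectation_mx P
    (fun w => regressor s (X w) (D w) *m (regressor s (X w) (D w))^T)) ->
  0 < fine (P (D @^-1` [set a])).
Proof.
set M := expectation_mx _ _; move=> [_ posM].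
pose c := @const_idx q; pose t := @treat_idx q.
have ME i j : M i j =
    fine 'E_P[fun w =>
      regressor s (X w) (D w) i 0 * regressor s (X w) (D w) j 0].
  rewrite mxE; congr (fine 'E_P[_]); apply/funext => w.
  by rewrite mxE big_ord1 [X in _ * X]mxE.
have Mcc : M c c = 1.
  rewrite ME (_ : (fun _ => _) = cst 1) ?expectation_cst//.
  by apply/funext => w; rewrite regressor_const mulr1.
have Mct : M c t = fine (P (D @^-1` [set true])).
  rewrite ME -expectation_treated; congr (fine 'E_P[_]); apply/funext => w.
  by rewrite regressor_const regressor_treat mul1r.
have Mtc : M t c = fine (P (D @^-1` [set true])).
  rewrite ME -expectation_treated; congr (fine 'E_P[_]); apply/funext => w.
  by rewrite regressor_const regressor_treat mulr1.
have Mtt : M t t = fine (P (D @^-1` [set true])).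
  rewrite ME -expectation_treated; congr (fine 'E_P[_]); apply/funext => w.
  by rewrite regressor_treat; case: (D w); rewrite ?mulr1 ?mulr0.
have t0 (k : R) : delta_mx t 0 - k *: delta_mx c 0 != 0 :> 'cV[R]_(1 + (1 + q)).
  apply/eqP => /matrixP/(_ t 0); rewrite !mxE !eqxx /=.
  by rewrite mulr0 subr0 => /eqP; rewrite oner_eq0.
pose k : R := (~~ a)%:R.
have := posM _ (t0 k).
rewrite [(_ - _)^T]raddfB/= [in X in X *m _]linearZ/= mulmxBr !mulmxBl.
rewrite -!scalemxAl -!scalemxAr.
have subE (A B : 'M[R]_1) : (A - B) 0 0 = A 0 0 - B 0 0 by rewrite !mxE.
have scaleE b (A : 'M[R]_1) : (b *: A) 0 0 = b * A 0 0 by rewrite mxE.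
rewrite !(subE, scaleE) !mx_delta_form Mcc Mct Mtc Mtt.
rewrite {}/k; case: a => /=; rewrite ?mul0r ?mul1r => lt0; first by lra.
have -> : D @^-1` [set false] = ~` (D @^-1` [set true]).
  by apply/seteqP; split => w /=; case: (D w).
rewrite probability_setC ?fineB ?fin_num_measure//;
  try exact: measurable_treatment.
by move: lt0 => /=; lra.
Qed.

End posdef_treatment.

(** * Outcome means within a treatment arm *)

Section regression.
Context {disp : measure_display} {T : measurableType disp} {R : realType}.
Context {P : probability T R} {p q : nat}.
Variables (Y : {RV P >-> R}) (X : {RV P >-> borel_cV R p}).
Variables (D : {RV P >-> bool}) (G : bool -> probability (borel_cV R p) R).
Hypothesis hG : cond_law_X P X D G.
Variables (s : 'cV[R]_p -> 'cV[R]_q) (alpha beta : R) (gamma : 'cV[R]_q).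
Variable E : {RV P >-> R}.
Hypothesis hmodel : forall w, Y w =
  alpha + beta * (D w)%:R + ((s (X w))^T *m gamma) 0 0 + E w.
Hypothesis hZE :
  ('E_P[fun w => (enorm (E w *: regressor s (X w) (D w)))%R] < +oo)%E.
Hypothesis horth :
  expectation_mx P (fun w => E w *: regressor s (X w) (D w)) = 0.
Hypothesis hfin : forall a, finite_set (support_of (G a)).

Let l := lin_reg s alpha beta gamma.
Let ev a : set T := D @^-1` [set a].
Let cell a x : set T := ev a `&` X @^-1` [set x].

Let mev a : measurable (ev a). Proof. exact: measurable_treatment. Qed.

Let mpreX (A : set (borel_cV R p)) : measurable A -> measurable (X @^-1` A).
Proof. by move=> mA; rewrite -(setTI (X @^-1` A)); exact: measurable_funP. Qed.

Let m1 (x : borel_cV R p) : measurable [set x].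
Proof. exact: measurable_cV1. Qed.

Lemma measurable_cell a x : measurable (cell a x).
Proof. by apply: measurableI => //; apply: mpreX. Qed.

Lemma prob_cell a x :
  fine (P (cell a x)) = fine (P (ev a)) * fine (G a [set x]).
Proof.
rewrite /cell setIC hG; last exact: m1.
by rewrite fineM//; apply: fin_num_measure => //; exact: mev.
Qed.

(** By [hG] this probability has as a factor the mass of [G a] off its support. The event [D = a]
    can therefore be cut into the finitely many cells over that support. *)
Lemma off_support_null a : P (ev a `\` X @^-1` support_of (G a)) = 0%E.
Proof.
have mS : measurable (support_of (G a) : set (borel_cV R p)).
  exact: measurable_support.
rewrite setDE preimage_setC setIC hG; last exact: measurableC.
rewrite probability_setC// [X in (_ - X)%E](support_mass1 (G a)).
by rewrite subee// mule0.
Qed.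

(** The entry of the vector [E Z] at the constant regressor is [E] itself, so [|E|] is dominated by
    a norm of finite mean. *)
Lemma integrable_error : P.-integrable setT (EFin \o E).
Proof.
move: hZE; rewrite unlock; apply: integrable_of_le => // w.
apply: le_trans (norm_le_enorm _ (@const_idx q)).
by rewrite mxE regressor_const mulr1.
Qed.

Let iE a : P.-integrable (ev a) (EFin \o E).
Proof. by apply: (integrableS measurableT (mev a) _ integrable_error). Qed.

Lemma Rintegral_error_treatment a : \int[P]_(w in ev a) E w = 0.
Proof.
have /matrixP hE := horth.
have ET : \int[P]_w E w = 0.
  have := hE (@const_idx q) 0; rewrite !mxE unlock /Rintegral => <-.
  congr fine; apply: eq_integral => w _.
  by rewrite mxE regressor_const mulr1.
(* The treatment entry of [E Z] is [E] times the indicator of [D = 1]. The case [D = 0] then follows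
   by subtraction from the integral over the whole space. *)
have E1 : \int[P]_(w in ev true) E w = 0.
  have := hE (@treat_idx q) 0; rewrite !mxE unlock => <-.
  rewrite Rintegral_mkcond /Rintegral; congr fine; apply: eq_integral => w _.
  rewrite mxE regressor_treat patchE.
  case: ifPn => [/set_mem Dw|]; first by rewrite (Dw : D w = true) mulr1.
  by rewrite notin_setE /ev/=; case: (D w) => // _; rewrite mulr0.
case: a => //.
have TE : [set: T] = ev true `|` ev false.
  by apply/seteqP; split => // w _; rewrite /ev/=; case: (D w); [left|right].
move: ET; rewrite TE Rintegral_setU ?E1 ?add0r// -?TE.
  exact: integrable_error.
by apply/disj_setPS => w; rewrite /ev => -[/= Dt Df]; move: Dt; rewrite Df.
Qed.

Let model_cell a x w : w \in cell a x -> Y w = l x a + E w.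
Proof. by move=> /set_mem[/= <- <-]; rewrite hmodel. Qed.

Let iEcell a x : P.-integrable (cell a x) (EFin \o E).
Proof.
by apply: (integrableS measurableT (measurable_cell a x) _ integrable_error).
Qed.

Let icst a x (k : R) : P.-integrable (cell a x) (EFin \o cst k).
Proof. exact/finite_measure_integrable_cst/measurable_cell. Qed.

Lemma Rintegral_outcome_cell a x :
  \int[P]_(w in cell a x) Y w =
  l x a * fine (P (cell a x)) + \int[P]_(w in cell a x) E w.
Proof.
have mc := measurable_cell a x.
rewrite (@eq_Rintegral _ _ _ _ _ (fun w => cst (l x a) w + E w)); last first.
  exact: model_cell.
by rewrite RintegralD// Rintegral_cst.
Qed.

(** What has to be shown is that [Y] is integrable over the arm: on each cell it is a constant plus
    the integrable [E], and finitely many cells matter. *)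
Lemma Rintegral_outcome_treatment a :
  \int[P]_(w in ev a) Y w =
  \sum_(x <- fset_set (support_of (G a))) \int[P]_(w in cell a x) Y w.
Proof.
apply: (Rintegral_finite_fibres (mev a) _ m1 (hfin a)
  (off_support_null a)) => //.
apply: (integrable_finite_fibres (mev a) _ m1 (hfin a)
  (off_support_null a)) => //.
  exact: measurable_funTS.
move=> x _; have mc := measurable_cell a x.
apply: (eq_integrable mc ((EFin \o cst (l x a)) \+ (EFin \o E))%E).
  by move=> w wc; rewrite /= (model_cell wc).
exact: integrableD.
Qed.

(** The error may have a nonzero integral over a single cell; only the sum over the cells of an arm
    is known to vanish. The outcome integrals are therefore summed first. *)
Lemma Rintegral_outcome_lin_reg a :
  \int[P]_(w in ev a) Y w =
  fine (P (ev a)) * support_mean (G a) (fun x => l x a).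
Proof.
have := Rintegral_error_treatment a.
rewrite (Rintegral_finite_fibres (mev a) _ m1 (hfin a) (off_support_null a))//.
rewrite Rintegral_outcome_treatment => E0.
under eq_bigr do rewrite Rintegral_outcome_cell.
rewrite big_split/= E0 addr0 support_meanE// mulr_sumr.
by apply: eq_bigr => x _; rewrite prob_cell mulrCA.
Qed.

Section outcome_kernel.
Variable F : 'cV[R]_p -> bool -> probability R R.
Let S := support_of (G false) `|` support_of (G true).
Hypothesis hF : cond_law_Y P Y X D S F.
Hypothesis hFmean : forall x a, S x -> (F x a).-integrable [set: R] EFin.

(** On a cell [X] equals [x], so the kernel is constant in [w] there. Thus [hF] becomes the product
    identity that [Rintegral_conditional_law] asks for with the single law [F x a]. *)
Lemma Rintegral_outcome_kernel a :
  \int[P]_(w in ev a) Y w =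
  fine (P (ev a)) * support_mean (G a) (fun x => cond_mean_fun F x a).
Proof.
rewrite Rintegral_outcome_treatment support_meanE// mulr_sumr !big_seq.
apply: eq_bigr => x; rewrite in_fset_set// => /set_mem Gx.
have Sx : S x by case: a Gx => ?; [right|left].
rewrite (Rintegral_conditional_law (measurable_cell a x) _ (hFmean a Sx)).
  by rewrite prob_cell mulrAC -mulrA; congr (_ * _); rewrite mulrC.
move=> B mB; rewrite /cell (setIC (ev a)) setIA hF//.
have -> : [set x] `&` S = [set x] by apply/seteqP; split => [y []//|y /= ->].
rewrite (eq_integral (cst (F x a B))); last by move=> w /set_mem[/= -> _].
rewrite integral_cst; last by apply: measurableI; [apply: mpreX|exact: mev].
exact: muleC.
Qed.

End outcome_kernel.

End regression.

(** * Bounds on the gap between the regression coefficient and the estimand *)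

Theorem corollary3 (disp : measure_display) (T : measurableType disp)
  (R : realType) (P : probability T R) (p q : nat)
  (Y : {RV P >-> R}) (X : {RV P >-> borel_cV R p}) (D : {RV P >-> bool})
  (* conditional laws and mean *)
  (G : bool -> probability (borel_cV R p) R)
  (F : 'cV[R]_p -> bool -> probability R R)
  (hG : cond_law_X P X D G)
  (hF : cond_law_Y P Y X D (support_of (G false) `|` support_of (G true)) F)
  (hFmean : forall x a, (support_of (G false) `|` support_of (G true)) x ->
     (F x a).-integrable [set: R] EFin)
  (* regression model *)
  (s : 'cV[R]_p -> 'cV[R]_q) (alpha beta : R) (gamma : 'cV[R]_q)
  (E : {RV P >-> R})
  (hs : measurable_fun [set: T] (fun w => s (X w) : borel_cV R q))
  (hmodel : forall w, Y w =
     alpha + beta * (D w)%:R + ((s (X w))^T *m gamma) 0 0 + E w)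
  (hZ2 : ('E_P[fun w => (enorm (regressor s (X w) (D w)) ^+ 2)%R] < +oo)%E)
  (hZE : ('E_P[fun w => (enorm (E w *: regressor s (X w) (D w)))%R] < +oo)%E)
  (hpos : posdef (expectation_mx P (fun w =>
     regressor s (X w) (D w) *m (regressor s (X w) (D w))^T)))
  (horth : expectation_mx P (fun w => E w *: regressor s (X w) (D w)) = 0)
  (hfin : forall a, finite_set (support_of (G a)))
  (* minimum distance problems *)
  (J : finType) (r : 'cV[R]_p -> J -> R) (L : \bar R) (hL : (0 <= L)%E)
  (zeta : R -> J -> R) (xi : R -> bool -> 'cV[R]_p -> R)
  (hsol : forall sigma : R, sigma \in [:: 1; -1] ->
     MD_solution G (cond_mean_fun F) (lin_reg s alpha beta gamma) r L
       sigma (zeta sigma) (xi sigma)) :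
  let f := cond_mean_fun F in
  let m_ sigma j := `|zeta sigma j| in
  let m j := Num.max (m_ 1 j) (m_ (-1) j) in
  let c j := `|support_mean (G true) (r^~ j) - support_mean (G false) (r^~ j)|
  in
  let slack sigma := \sum_(a : bool) support_mean (G a) (xi sigma a) in
  [/\ - dot (m_ (-1)) c - slack (-1) <= beta - tau P Y D G f,
      beta - tau P Y D G f <= dot (m_ 1) c + slack 1
    & `|beta - tau P Y D G f|
        <= dot m c + \sum_(sigma <- [:: 1; -1]) slack sigma].
Proof.
move=> f m_ m c slack.
pose l := lin_reg s alpha beta gamma.
(* Both arms have positive probability, so that of [D = 1] can be divided by in [cond_mean] and that
   of [D = 0] cancelled in [h0]. *)
have p_gt0 a := posdef_treatment_gt0 a hpos.
have meanY1 : cond_mean P Y (D @^-1` [set true]) =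
    support_mean (G true) (fun x => l x true).
  rewrite /cond_mean (Rintegral_outcome_lin_reg hG hmodel hZE horth hfin).
  by rewrite mulrC mulKf// gt_eqF.
(* The integral of [Y] over [D = 0] is computed once through [l] and once through the kernel;
   cancelling the probability of the arm equates the two means. *)
have h0 : support_mean (G false) (fun x => f x false - l x false) = 0.
  rewrite support_meanB//; apply/eqP; rewrite subr_eq0; apply/eqP.
  have /(_ false) := Rintegral_outcome_lin_reg hG hmodel hZE horth hfin.
  rewrite (Rintegral_outcome_kernel hG hmodel hZE hfin hF)//.
  by move=> /mulfI-> //; rewrite gt_eqF.
have biasE : beta - tau P Y D G f =
    support_mean (G true) (fun x => f x false - l x false).
  rewrite /tau meanY1 support_meanB//.
  (* Switching the treatment on shifts [l] by [beta] at every [x]. *)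
  rewrite (_ : support_mean (G true) (fun x => l x true) =
      beta + support_mean (G true) (fun x => l x false)); first by ring.
  rewrite -[in RHS](support_mean_cst (G true) beta) -support_meanD//.
  by apply: eq_support_mean => // x _; rewrite /l /lin_reg/=; ring.
have bound (sigma : R) : sigma \in [:: 1; -1] ->
    sigma * (beta - tau P Y D G f) <= dot (m_ sigma) c + slack sigma.
  move=> hsigma; have [feas _] := hsol sigma hsigma.
  rewrite biasE; apply: MD_feasible_bound feas => //.
  by move: hsigma; rewrite !inE => /orP[] /eqP->; rewrite ?normrN normr1.
(* The sign 1 gives the upper bound, and the sign -1 bounds the negated gap, which is the lower
   bound. *)
have up := bound 1 (mem_head _ _).
have lo := bound (-1) (mem_last 1 [:: -1]).
(* The two-sided bound carries the slacks of both signs, so each one-sided bound is enlarged by the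
   nonnegative slack of the other sign. *)
have slack_ge0 (sigma : R) : sigma \in [:: 1; -1] -> 0 <= slack sigma.
  move=> hsigma; have [[xi0 _ _] _] := hsol sigma hsigma.
  by apply: sumr_ge0 => a _; apply: support_mean_ge0 => // x; exact: xi0.
have s1 := slack_ge0 1 (mem_head _ _).
have s2 := slack_ge0 (-1) (mem_last 1 [:: -1]).
have dot_le (u : J -> R) : (forall j, u j <= m j) -> dot u c <= dot m c.
  by move=> um; apply: ler_sum => j _; rewrite ler_wpM2r// /c.
have d1 : dot (m_ 1) c <= dot m c by apply: dot_le => j; rewrite le_max lexx.
have d2 : dot (m_ (-1)) c <= dot m c.
  by apply: dot_le => j; rewrite le_max lexx orbT.
rewrite mul1r in up; rewrite mulN1r in lo.
split; [lra|exact: up|].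
rewrite big_cons big_seq1 ler_norml; apply/andP; split; lra.
Qed.
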